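(* If $G$ is a finite simple graph which is both $(P_3\cup P_2)$-free and $HVN$-free with $\omega(G)\geq 4$, then $\chi(G)\leq\omega(G)+1$.
   Context: All graphs are finite, simple, undirected. $\omega$ is the clique number and $\chi$ the chromatic number. $P_3\cup P_2$ is the disjoint union of a path on 3 vertices and a path on 2 vertices. $HVN$ is the graph $(K_1\cup K_2)+K_2$, i.e. a $K_4$ together with one extra vertex adjacent to exactly two vertices of the $K_4$. A graph is $H$-free if it has no induced subgraph isomorphic to $H$. *)

(* Defs.v *)
From mathcomp Require Import all_boot.

Set Implicit Arguments.
Unset Strict Implicit.
Unset Printing Implicit Defensive.

Record sgraph := SGraph {
  vertex :> finType;
  adj : rel vertex;
  adj_sym : symmetric adj;
  adj_irr : irreflexive adj
}.

Section Constructions.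

Definition path_rel n : rel 'I_n := fun i j => (i.+1 == j) || (j.+1 == i).

Lemma path_rel_sym n : symmetric (@path_rel n).
Proof. by move=> i j; rewrite /path_rel orbC. Qed.

Lemma path_rel_irr n : irreflexive (@path_rel n).
Proof. by move=> i; rewrite /path_rel gtn_eqF. Qed.

(* The index is the number of vertices, so [path_graph 3] has two edges. *)
Definition path_graph n := SGraph (@path_rel_sym n) (@path_rel_irr n).

Definition complete_rel n : rel 'I_n := fun i j => i != j.

Lemma complete_rel_sym n : symmetric (@complete_rel n).
Proof. by move=> i j; rewrite /complete_rel eq_sym. Qed.

Lemma complete_rel_irr n : irreflexive (@complete_rel n).
Proof. by move=> i; rewrite /complete_rel eqxx. Qed.

Definition complete_graph n :=
  SGraph (@complete_rel_sym n) (@complete_rel_irr n).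

(* With [b = false] there are no edges between the two sides (disjoint union);
   with [b = true] there are all of them (join). *)
Definition sum_rel (b : bool) (G H : sgraph) : rel (G + H)%type :=
  fun u v => match u, v with
             | inl x, inl y => adj x y
             | inr x, inr y => adj x y
             | _, _ => b
             end.

Lemma sum_rel_sym b G H : symmetric (@sum_rel b G H).
Proof. by move=> [x|x] [y|y] //=; rewrite adj_sym. Qed.

Lemma sum_rel_irr b G H : irreflexive (@sum_rel b G H).
Proof. by move=> [x|x] /=; rewrite adj_irr. Qed.

Definition disjoint_union G H :=
  SGraph (@sum_rel_sym false G H) (@sum_rel_irr false G H).

Definition join G H := SGraph (@sum_rel_sym true G H) (@sum_rel_irr true G H).

Variables (G : sgraph) (A : {set G}).

Definition induced_rel : rel {x : G | x \in A} :=
  fun u v => adj (val u) (val v).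

Lemma induced_rel_sym : symmetric induced_rel.
Proof. by move=> u v; rewrite /induced_rel adj_sym. Qed.

Lemma induced_rel_irr : irreflexive induced_rel.
Proof. by move=> u; rewrite /induced_rel adj_irr. Qed.

Definition induced := SGraph induced_rel_sym induced_rel_irr.

End Constructions.

Definition isomorphic (G H : sgraph) : Prop :=
  exists2 f : G -> H, bijective f & forall x y, adj (f x) (f y) = adj x y.

Definition induced_free (H G : sgraph) : Prop :=
  forall A : {set G}, ~ isomorphic (induced A) H.

Definition P3_cup_P2 : sgraph := disjoint_union (path_graph 3) (path_graph 2).

Definition HVN : sgraph :=
  join (disjoint_union (complete_graph 1) (complete_graph 2))
       (complete_graph 2).

Section Invariants.

Variable G : sgraph.

Definition clique (A : {set G}) : bool :=
  [forall x in A, forall y in A, (x != y) ==> adj x y].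

Definition clique_number : nat := \max_(A : {set G} | clique A) #|A|.

Definition proper_coloring k (c : {ffun G -> 'I_k}) : bool :=
  [forall x, forall y, adj x y ==> (c x != c y)].

Definition colorable k : bool :=
  [exists c : {ffun G -> 'I_k}, proper_coloring c].

Lemma colorable_ex : exists k, colorable k.
Proof.
exists #|G|; apply/existsP; exists [ffun x => enum_rank x].
apply/forallP => x; apply/forallP => y; apply/implyP => xy.
by rewrite !ffunE (inj_eq enum_rank_inj); apply: contraL xy => /eqP ->;
  rewrite adj_irr.
Qed.

Definition chromatic_number : nat := ex_minn colorable_ex.

End Invariants.

(* Main.v *)
Require Import Defs.
From mathcomp Require Import all_boot zify.

Set Implicit Arguments.
Unset Strict Implicit.
Unset Printing Implicit Defensive.

(** Fix a maximum clique K, with w = #|K| >= 4.  HVN-freeness lets a vertex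
    outside K have only 0, 1 or w - 1 neighbors in K.  The vertices whose only
    nonneighbor in K is i form, with i, an independent set [part i]; the parts
    are pairwise completely joined, and a vertex y of the remaining set [outer]
    has neighbors in at most one part.  Give the color [Some i] to [part i]; it
    remains to color [outer] with these w colors and the extra color [None],
    where y avoids at most one color.  This is greedy when every vertex has
    fewer than w neighbors in [outer].

    Otherwise [outer] contains an induced P3.  Every edge between two parts must
    be touched by it, which forces w = 4, with the three vertices of the P3
    attached to distinct parts, and each of them complete to its part.  A vertex
    of outer degree at least 4 then yields adjacent vertices q, q' of [outer]
    attached to the same part i and lying in induced P3's; they are twins in
    [outer].  The neighbors of q not attached to part i form an independent set
    N, as otherwise q, q', two adjacent members of N, and i induce HVN.  Give
    [None] to N.  The rest of [outer] is P3-free because of the edge qq', so it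
    is a disjoint union of cliques, which can be colored from K by Hall's
    condition. *)

(** * Forbidden induced subgraphs as adjacency conditions *)

Lemma induced_free_embedding (H G : sgraph) (f : H -> G) :
  induced_free H G -> injective f ->
  ~ (forall x y, adj (f x) (f y) = adj x y).
Proof.
move=> freeG injf adjf; apply: (freeG [set f x | x in [set: H]]).
have inA (x : H) : f x \in [set f x | x in [set: H]] by rewrite imset_f.
have preim (u : induced [set f x | x in [set: H]]) : exists x, f x == val u.
  by case: u => u /= /imsetP[x _ ->]; exists x.
pose g u := xchoose (preim u).
have gK u : f (g u) = val u by apply/eqP/(xchooseP (preim u)).
exists g => [|u v]; last by rewrite -adjf !gK.
exists (fun x => Sub (f x) (inA x)) => [u|x]; last by apply: injf; rewrite gK.
by apply: val_inj; rewrite /= gK.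
Qed.

(** Among the distinctness facts only [a != c] is assumed: if an end of [xy] were one of [a], [b],
    [c], the other end would be adjacent to it, which is one of the six disjuncts. *)
Lemma P3_cup_P2_free_adj (G : sgraph) (a b c x y : G) :
  induced_free P3_cup_P2 G ->
  adj a b -> adj b c -> ~~ adj a c -> a != c -> adj x y ->
  [|| adj x a, adj x b, adj x c, adj y a, adj y b | adj y c].
Proof.
move=> freeG ab bc /negbTE nac nca xy; apply: contraPT freeG.
rewrite !negb_or => /and5P[/negbTE xa /negbTE xb /negbTE xc /negbTE ya].
case/andP=> /negbTE yb /negbTE yc.
pose f (u : P3_cup_P2) : G :=
  match u with
  | inl i => nth a [:: a; b; c] i
  | inr i => nth x [:: x; y] i
  end.
move=> /(@induced_free_embedding _ _ f); apply.
- have irr := @adj_irr G; have sym := @adj_sym G; move/eqP: nca => nca; rewrite /is_true in ab bc xy *.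
  move=> [[[|[|[|//]]] i]|[[|[|//]] i]] [[[|[|[|//]]] j]|[[|[|//]] j]] //= E;
    try (by congr inl; apply: val_inj); try (by congr inr; apply: val_inj);
  by congruence.
- move=> [[[|[|[|//]]] i]|[[|[|//]] i]] [[[|[|[|//]]] j]|[[|[|//]] j]] //=;
  by rewrite ?adj_irr // ?ab ?bc ?nac ?xy ?xa ?xb ?xc ?ya ?yb ?yc // adj_sym
       ?ab ?bc ?nac ?xy ?xa ?xb ?xc ?ya ?yb ?yc.
Qed.

(** Here [a], [b] form the joined [K_2], and [x] faces the edge [cd]. Adjacency separates all pairs
    except [x] from [c] and from [d]. *)
Lemma HVN_free_adj (G : sgraph) (a b c d x : G) :
  induced_free HVN G ->
  adj a b -> adj a c -> adj a d -> adj b c -> adj b d -> adj c d ->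
  adj x a -> adj x b -> c != x -> d != x -> adj x c || adj x d.
Proof.
move=> freeG ab ac ad bc bd cd xa xb cx dx; apply: contraPT freeG.
rewrite negb_or => /andP[/negbTE xc /negbTE xd].
pose f (u : HVN) : G :=
  match u with
  | inl (inl i) => x
  | inl (inr i) => nth c [:: c; d] i
  | inr i => nth a [:: a; b] i
  end.
move=> /(@induced_free_embedding _ _ f); apply.
- have irr := @adj_irr G; move/eqP: cx => cx; move/eqP: dx => dx.
  rewrite /is_true in ab ac ad bc bd cd xa xb *.
  move=> [[[[|//] i]|[[|[|//]] i]]|[[|[|//]] i]] [[[[|//] j]|[[|[|//]] j]]|[[|[|//]] j]] //= E;
    try (by congr (inl (inl _)); apply: val_inj);
    try (by congr (inl (inr _)); apply: val_inj);
    try (by congr inr; apply: val_inj);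
  by congruence.
- move=> [[[[|//] i]|[[|[|//]] i]]|[[|[|//]] i]] [[[[|//] j]|[[|[|//]] j]]|[[|[|//]] j]] //=;
  by rewrite ?adj_irr // ?ab ?ac ?ad ?bc ?bd ?cd ?xa ?xb ?xc ?xd // adj_sym
       ?ab ?ac ?ad ?bc ?bd ?cd ?xa ?xb ?xc ?xd.
Qed.

(** * Cliques and the chromatic number *)

Lemma adj_neq (G : sgraph) (x y : G) : adj x y -> x != y.
Proof. by apply: contraTneq => ->; rewrite adj_irr. Qed.

Lemma cliqueP (G : sgraph) (A : {set G}) :
  reflect {in A &, forall x y, x != y -> adj x y} (clique A).
Proof.
apply: (iffP 'forall_in_'forall_in_implyP) => cl x xA y yA; first exact: cl.
by move=> xy; apply: cl.
Qed.

Lemma clique_setU1 (G : sgraph) (A : {set G}) x :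
  clique A -> {in A, forall y, adj x y} -> clique (x |: A).
Proof.
move=> /cliqueP clA xA; apply/cliqueP => y z /setU1P[->|yA] /setU1P[->|zA].
- by rewrite eqxx.
- by move=> _; apply: xA.
- by move=> _; rewrite adj_sym; apply: xA.
- exact: clA.
Qed.

(** Colors may come from a subset of any finite type, so that vertices of the clique can serve as
    colors. *)
Lemma chromatic_number_le (G : sgraph) (C : finType) (P : {set C}) (f : G -> C) :
  (forall x, f x \in P) -> (forall x y, adj x y -> f x != f y) ->
  chromatic_number G <= #|P|.
Proof.
move=> fP properf; rewrite /chromatic_number; case: ex_minnP => m _; apply.
(* [enum_rank_in] needs an element of [P]; a vertex supplies one, so the empty graph is treated
   apart. *)
case: (pickP (@predT G)) => [x0 _|G0]; last first.
  apply/existsP; exists (ffun0 (eq_card0 G0)).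
  by apply/forallP => x; have := G0 x.
apply/existsP; exists [ffun x => enum_rank_in (fP x0) (f x)].
apply/'forall_'forall_implyP => x y xy; rewrite !ffunE.
apply: contra (properf x y xy) => /eqP E; apply/eqP.
exact: (enum_rank_in_inj (fP x) (fP y) E).
Qed.

(** * List colorings *)

Section ListColoring.

Variables (G : sgraph) (C : finType).
Implicit Types (L : G -> {set C}) (f : G -> C) (A B D S : {set G}).

Definition nbrs (x : G) := [set y | adj x y].

Definition list_coloring L S f : Prop :=
  {in S, forall x, f x \in L x} /\ {in S &, forall x y, adj x y -> f x != f y}.

Lemma card_nbrs_lt A x : x \in A -> #|A :&: nbrs x| < #|A|.
Proof.
move=> xA; apply/proper_card/properP; split; first exact: subsetIl.
by exists x; rewrite // !inE adj_irr andbF.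
Qed.

(** Degeneracy: a vertex with fewer neighbors in [S] than colors is removed and colored last. [c0]
    only serves as the value on an empty set. *)
Lemma greedy_list_coloring (c0 : C) L S :
  (forall A, A \subset S -> A != set0 ->
     exists2 x, x \in A & #|A :&: nbrs x| < #|L x|) ->
  exists f, list_coloring L S f.
Proof.
have [n] := ubnP #|S|; elim: n S => // n IHn S ltSn degS.
have [->|S0] := eqVneq S set0.
  by exists (fun=> c0); split=> [x|x y]; rewrite inE.
have [x xS ltx] := degS S (subxx _) S0.
have [|A sAS|f [fL fadj]] := IHn (S :\ x).
- by rewrite (cardsD1 x) xS ltnS in ltSn.
- by apply: degS; apply: subset_trans sAS (subsetDl _ _).
have [c cL cfree] : exists2 c, c \in L x & c \notin f @: (S :&: nbrs x).
  apply/subsetPn; apply: contraL ltx => /subset_leq_card le.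
  by rewrite -leqNgt (leq_trans le) ?leq_imset_card.
have cf y : y \in S -> adj x y -> c != f y.
  move=> yS xy; apply: contraNneq cfree => ->; apply: imset_f.
  by rewrite !inE yS.
exists (fun y => if y == x then c else f y); split=> [y yS|y z yS zS yz].
  by have [->//|yx] := eqVneq y x; apply: fL; rewrite !inE yx.
have [Ey|yx] := eqVneq y x; have [Ez|zx] := eqVneq z x.
- by rewrite Ey Ez adj_irr in yz.
- by apply: cf; rewrite -?Ey.
- by rewrite eq_sym; apply: cf; rewrite -?Ez // adj_sym.
- by apply: fadj => //; rewrite !inE ?yx ?zx.
Qed.

Lemma list_coloring_union L A B f g :
  list_coloring L A f -> list_coloring L B g ->
  {in A & B, forall x y, ~~ adj x y} ->
  list_coloring L (A :|: B) (fun x => if x \in A then f x else g x).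
Proof.
move=> [fL fadj] [gL gadj] nAB; split=> [x|x y].
  by rewrite inE; case: ifP => /= xA; [move=> _; apply: fL | apply: gL].
rewrite !inE; case: ifP => xA; case: ifP => yA /=.
- by move=> _ _; apply: fadj.
- by move=> _ yB; rewrite (negbTE (nAB x y xA yB)).
- by move=> xB _; rewrite adj_sym (negbTE (nAB y x yA xB)).
- exact: gadj.
Qed.

(** Without induced P3 the component [D] of [x] is its closed neighborhood and a clique; it is
    colored by itself and the rest by induction. *)
Lemma P3_free_list_coloring (c0 : C) L S :
  {in S & &, forall x y z, adj x y -> adj y z -> x != z -> adj x z} ->
  (forall D, D \subset S -> clique D -> exists f, list_coloring L D f) ->
  exists f, list_coloring L S f.
Proof.
have [n] := ubnP #|S|; elim: n S => // n IHn S ltSn P3free cliqueL.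
have [->|[x xS]] := set_0Vmem S.
  by exists (fun=> c0); split=> [x|x y]; rewrite inE.
pose D := [set y in S | (y == x) || adj x y].
have xD : x \in D by rewrite inE xS eqxx.
have sDS : D \subset S by apply/subsetP => y; rewrite inE => /andP[].
have [||f fD] := cliqueL D; rewrite ?sDS //.
  apply/cliqueP => y z; rewrite !inE => /andP[yS yx] /andP[zS zx] yz.
  have [Ey|yx'] := eqVneq y x; have [Ez|zx'] := eqVneq z x.
  - by rewrite Ey Ez eqxx in yz.
  - by rewrite Ey; rewrite (negbTE zx') in zx.
  - by rewrite Ez adj_sym; rewrite (negbTE yx') in yx.
  - rewrite (negbTE yx') (negbTE zx') /= in yx zx.
    by apply: (P3free y x z); rewrite // adj_sym.
have [||A sA|g gD] := IHn (S :\: D).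
- rewrite -ltnS (leq_trans _ ltSn) // ltnS.
  apply/proper_card/properP; split; first exact: subsetDl.
  by exists x => //; rewrite inE xD.
- by move=> y z t /setDP[yS _] /setDP[zS _] /setDP[tS _]; apply: P3free.
- by apply: cliqueL; apply: subset_trans sA (subsetDl _ _).
exists (fun y => if y \in D then f y else g y).
have -> : S = D :|: (S :\: D) by rewrite -[LHS](setID S D) (setIidPr sDS).
apply: list_coloring_union => // y z; rewrite !inE.
case/andP=> yS yx; case/andP=> + zS; rewrite zS /= negb_or => /andP[zx nxz].
apply: contra nxz => yz; case/predU1P: yx => [<-//|xy].
by apply: (P3free x y z); rewrite // eq_sym.
Qed.

(* Hall's condition can only fail when every vertex of a set of size [#|K|]
   forbids the same color. *)
Lemma small_list_coloring (c0 : C) (K : {set C}) (h : G -> {set C}) D :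
  {in D, forall x, #|h x| <= 1} -> #|D| <= #|K| ->
  (forall c, c \in K -> {in D, forall x, c \in h x} -> #|D| < #|K|) ->
  exists f, list_coloring (fun x => K :\: h x) D f.
Proof.
move=> h1 leDK notall.
have cardL (A : {set C}) x : x \in D -> #|A| <= #|A :\: h x|.+1.
  move=> xD; rewrite -(cardsID (h x) A) -add1n leq_add2r.
  by rewrite (leq_trans _ (h1 x xD)) // subset_leq_card ?subsetIr.
have [ltDK|leKD] := ltnP #|D| #|K|.
  apply: greedy_list_coloring => // A sAD /set0Pn[x xA]; exists x => //.
  have xD := subsetP sAD x xA.
  rewrite (leq_trans (card_nbrs_lt xA)) // (leq_trans (subset_leq_card sAD)) //.
  by rewrite -ltnS (leq_trans ltDK) ?cardL.
have [/existsP[d1 /andP[d1D /existsP[c /andP[cK ch]]]]|none] :=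
  boolP [exists x in D, exists c in K, c \in h x]; last first.
  apply: greedy_list_coloring => // A sAD /set0Pn[x xA]; exists x => //.
  have xD := subsetP sAD x xA.
  rewrite (leq_trans (card_nbrs_lt xA)) // (leq_trans (subset_leq_card sAD)) //.
  rewrite (leq_trans leDK) // subset_leq_card //; apply/subsetP => c cK.
  rewrite inE cK andbT; apply: contra none => ch.
  by apply/exists_inP; exists x => //; apply/exists_inP; exists c.
have hd1 : h d1 = [set c].
  apply/eqP; rewrite eq_sym eqEcard sub1set ch cards1; exact: h1.
(* [d2] takes the color [c], and the rest is colored from [K :\ c]. There [d1] loses no further
   color, and a set avoiding both [d1] and [d2] has at most [#|K| - 2] vertices, so the greedy
   argument applies. *)
have [d2 d2D cd2] : exists2 d2, d2 \in D & c \notin h d2.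
  apply/exists_inP; apply: contraLR leKD; rewrite -ltnNge => /exists_inPn all.
  by apply: (notall c) => // x xD; rewrite -[_ \in _]negbK all.
have d12 : d1 != d2 by apply: contraNneq cd2 => <-.
have EK : #|K| = #|K :\ c|.+1 by rewrite (cardsD1 c K) cK.
have [|f [fL fadj]] :=
  @greedy_list_coloring c0 (fun x => (K :\ c) :\: h x) (D :\ d2).
  move=> A sAD A0.
  have ltA : #|A| < #|K|.
    apply: leq_trans leDK.
    by rewrite (cardsD1 d2 D) d2D ltnS subset_leq_card.
  have [d1A|d1A] := boolP (d1 \in A).
    exists d1 => //; rewrite (leq_trans (card_nbrs_lt d1A)) //.
    by rewrite hd1 setDDl setUid -ltnS -EK.
  have [x xA] := set0Pn _ A0; exists x => //.
  have xD : x \in D by have := subsetP sAD x xA; rewrite inE => /andP[].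
  rewrite (leq_trans (card_nbrs_lt xA)) // -ltnS.
  apply: leq_trans (cardL (K :\ c) x xD); rewrite -ltnS -EK.
  apply: leq_trans leDK; rewrite (cardsD1 d2 D) d2D (cardsD1 d1 (D :\ d2)).
  rewrite !inE d1D d12 !ltnS.
  apply/subset_leq_card/subsetP => y yA; rewrite in_setD1 (subsetP sAD) // andbT.
  by apply: contraNneq d1A => <-.
exists (fun x => if x == d2 then c else f x); split=> [x xD|x y xD yD xy].
  have [->|xd2] := eqVneq x d2; first by rewrite inE cd2.
  by have := fL x; rewrite !inE xd2 xD => /(_ isT) /andP[-> /andP[_ ->]].
have cf z : z \in D -> z != d2 -> f z != c.
  by move=> zD zd2; have := fL z; rewrite !inE zd2 zD => /(_ isT) /and3P[].
have [Ex|xd2] := eqVneq x d2; have [Ey|yd2] := eqVneq y d2.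
- by rewrite Ex Ey adj_irr in xy.
- by rewrite eq_sym cf.
- by rewrite cf.
- by apply: fadj; rewrite ?inE ?xd2 ?yd2.
Qed.

End ListColoring.

(** * Parts and outer vertices around a maximum clique *)

Section MaximumClique.

Variables (G : sgraph) (K : {set G}).
Hypotheses (P3P2free : induced_free P3_cup_P2 G) (HVNfree : induced_free HVN G).
Hypotheses (clK : clique K) (maxK : forall A : {set G}, clique A -> #|A| <= #|K|).
Hypothesis K_ge4 : 4 <= #|K|.

Definition part (i : G) := [set x | [forall k in K, adj x k == (k != i)]].

Definition outer := [set y | [forall i in K, y \notin part i]].

Definition hits (y : G) := [set i in K | [exists x in part i, adj y x]].

Let adjK : {in K &, forall k l, k != l -> adj k l}.
Proof. exact/cliqueP. Qed.

Lemma part_adjK i x k : x \in part i -> k \in K -> adj x k = (k != i).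
Proof. by rewrite inE => /forall_inP xi /xi/eqP. Qed.

Lemma part_refl i : i \in K -> i \in part i.
Proof.
move=> iK; rewrite inE; apply/forall_inP => k kK; rewrite eq_sym.
by have [->|ik] := eqVneq k i; rewrite ?adj_irr // adjK // eq_sym.
Qed.

Lemma outerNpart i y : y \in outer -> i \in K -> y \notin part i.
Proof. by rewrite inE => /forall_inP; apply. Qed.

Lemma outerNK y k : y \in outer -> k \in K -> y != k.
Proof.
by move=> yO kK; apply: contraNneq (outerNpart yO kK) => ->; apply: part_refl.
Qed.

Lemma mem_hits i x y : i \in K -> x \in part i -> adj y x -> i \in hits y.
Proof. by move=> iK xi yx; rewrite inE iK; apply/exists_inP; exists x. Qed.

Lemma hitsK i y : i \in hits y -> i \in K.
Proof. by rewrite inE => /andP[]. Qed.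

Lemma maxclique_nonadj (y : G) (A : {set G}) :
  clique A -> #|K| <= #|A| -> y \notin A -> exists2 k, k \in A & ~~ adj y k.
Proof.
move=> clA leKA yA; apply/exists_inP; apply: contraLR leKA.
rewrite -ltnNge => /exists_inPn yadj.
have: clique (y |: A) by apply: clique_setU1 => // k /yadj; rewrite negbK.
by move/maxK; rewrite cardsU1 yA.
Qed.

(** This is where [4 <= #|K|] provides the spare clique vertices for the copies of HVN below. *)
Lemma two_others i j :
  exists k l, [/\ k \in K, l \in K, k != l & [&& k != i, k != j, l != i & l != j]].
Proof.
have: 1 < #|K :\: [set i; j]|.
  have := cardsID [set i; j] K; have := subset_leq_card (subsetIr K [set i; j]).
  by rewrite cards2; lia.
case/card_gt1P=> k [l []]; rewrite !inE !negb_or.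
move=> /andP[/andP[ki kj] kK] /andP[/andP[li lj] lK] kl.
by exists k, l; split=> //; apply/and4P.
Qed.

(** Replacing [i] by [y] in [K] gives another maximum clique, to which [x] could be added if [x] and
    [y] were adjacent. *)
Lemma part_indep i x y : i \in K -> x \in part i -> y \in part i -> ~~ adj x y.
Proof.
move=> iK xi yi; apply/negP => xy.
have clA : clique (y |: K :\ i).
  apply: clique_setU1 => [|k /setD1P[ki kK]]; last by rewrite (part_adjK yi).
  by apply/cliqueP => k l /setD1P[_ kK] /setD1P[_ lK]; apply: adjK.
have yK : y \notin K :\ i.
  by rewrite !inE; apply/negP => /andP[yNi yK]; have := part_adjK yi yK; rewrite adj_irr yNi.
have xA : x \notin y |: K :\ i.
  rewrite !inE (negbTE (adj_neq xy)) /=; apply/negP => /andP[xNi xK].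
  by have := part_adjK xi xK; rewrite adj_irr xNi.
have [|k] := maxclique_nonadj clA _ xA.
  by rewrite cardsU1 yK (cardsD1 i K) iK.
by rewrite !inE => /predU1P[->|/andP[ki kK]]; rewrite ?xy // (part_adjK xi) // ki.
Qed.

(** In the K4 on [k], [l], [x], [j], the vertex [y] is adjacent to [k] and [l] but not to [j], hence
    to [x]. *)
Lemma part_join i j x y :
  i \in K -> j \in K -> i != j -> x \in part i -> y \in part j -> adj x y.
Proof.
move=> iK jK ij xi yj; have [k [l [kK lK kl /and4P[ki kj li lj]]]] := two_others i j.
have xj : adj x j by rewrite (part_adjK xi) // eq_sym.
have yNj : adj y j = false by rewrite (part_adjK yj) // eqxx.
have [<-//|jy] := eqVneq j y.
have xy : x != y by apply: contraFneq yNj => <-.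
have part_adj u : u \in K -> u != i -> adj u x.
  by move=> uK ui; rewrite adj_sym (part_adjK xi).
suff: adj y x || adj y j by rewrite yNj orbF adj_sym.
by apply: (@HVN_free_adj G k l x j y HVNfree);
  rewrite ?part_adj ?(part_adjK yj) ?xj // adjK.
Qed.

(** Maximality gives a nonneighbor [m] of [y] in [K], and [y] being outside [part m] gives a second
    one [m']; with two neighbors [k], [l] this would be HVN. *)
Lemma outer_adjK y k l :
  y \in outer -> k \in K -> l \in K -> adj y k -> adj y l -> k = l.
Proof.
move=> yO kK lK yk yl; apply/eqP/idPn => kl.
have yK : y \notin K by apply/negP => /(outerNK yO); rewrite eqxx.
have [m mK ym] := maxclique_nonadj clK (leqnn _) yK.
have := outerNpart yO mK; rewrite inE => /forall_inPn[m' m'K].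
have [->|m'm] := eqVneq m' m; first by rewrite (negbTE ym).
rewrite eqb_id => ym'.
have neq u v : adj y u -> ~~ adj y v -> u != v by move=> yu; apply: contraNneq => <-.
have Ky u : u \in K -> u != y by rewrite eq_sym; apply: outerNK.
suff: adj y m || adj y m' by rewrite (negbTE ym) (negbTE ym').
apply: (@HVN_free_adj G k l m m' y HVNfree) => //;
  by [apply: Ky | apply: adjK => //; apply: neq | rewrite adjK // eq_sym].
Qed.

(** Otherwise [y] has exactly the neighbors [k], [x] in the K4 on [k], [x], [j], [l]. *)
Lemma outer_part_adjK y i k x :
  y \in outer -> i \in K -> x \in part i -> adj y x ->
  k \in K -> k != i -> ~~ adj y k.
Proof.
move=> yO iK xi yx kK ki; apply/negP => yk.
have [j [l [jK lK jl /and4P[ji jk li lk]]]] := two_others i k.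
have nadj m : m \in K -> m != k -> ~~ adj y m.
  by move=> mK; apply: contraNN => ym; rewrite (outer_adjK yO mK kK ym yk).
have Ky u : u \in K -> u != y by rewrite eq_sym; apply: outerNK.
suff: adj y j || adj y l by rewrite (negbTE (nadj j _ _)) ?(negbTE (nadj l _ _)).
by apply: (@HVN_free_adj G k x j l y HVNfree) => //;
  by [apply: Ky | rewrite adjK // eq_sym | rewrite (part_adjK xi)
     | rewrite adj_sym (part_adjK xi)].
Qed.

(** If [i] and [j] differed, [y] would have exactly the neighbors [x], [z] in the K4 on [x], [z],
    [k], [l]. *)
Lemma outer_part_unique y i j x z :
  y \in outer -> i \in K -> j \in K -> x \in part i -> z \in part j ->
  adj y x -> adj y z -> i = j.
Proof.
move=> yO iK jK xi zj yx yz; apply/eqP/idPn => ij.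
have [k [l [kK lK kl /and4P[ki kj li lj]]]] := two_others i j.
have Ky u : u \in K -> u != y by rewrite eq_sym; apply: outerNK.
have xz := part_join iK jK ij xi zj.
have yk := outer_part_adjK yO iK xi yx kK ki.
have yl := outer_part_adjK yO iK xi yx lK li.
suff: adj y k || adj y l by rewrite (negbTE yk) (negbTE yl).
by apply: (@HVN_free_adj G x z k l y HVNfree) => //;
  by [apply: Ky | rewrite adjK | rewrite (part_adjK xi) | rewrite (part_adjK zj)].
Qed.

Lemma hits_unique y i j : y \in outer -> i \in hits y -> j \in hits y -> i = j.
Proof.
move=> yO; rewrite !inE => /andP[iK /exists_inP[x xi yx]].
by case/andP=> jK /exists_inP[z zj yz]; apply: (outer_part_unique yO iK jK xi zj).
Qed.

Lemma card_hits y : y \in outer -> #|hits y| <= 1.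
Proof. by move=> yO; apply/card_le1_eqP => i j *; apply: (hits_unique yO). Qed.

(** * Induced P3's among the outer vertices *)

Definition outer_P3 a b c :=
  [&& [&& a \in outer, b \in outer & c \in outer],
      adj a b, adj b c, ~~ adj a c & a != c].

Lemma outer_P3_touch a b c i j x y :
  outer_P3 a b c -> i \in K -> j \in K -> i != j ->
  x \in part i -> y \in part j ->
  exists2 v, v \in [:: a; b; c] & adj v x || adj v y.
Proof.
case/and5P=> _ ab bc ac nac iK jK ij xi yj.
have xy := part_join iK jK ij xi yj.
have := P3_cup_P2_free_adj P3P2free ab bc ac nac xy.
rewrite ![adj _ a]adj_sym ![adj _ b]adj_sym ![adj _ c]adj_sym.
by case/or4P=> [E|E|E|/or3P[]E]; [exists a|exists b|exists c|exists a|exists b|exists c];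
  rewrite ?E ?inE ?eqxx ?orbT.
Qed.

(* At most one part is missed by the P3, since two missed parts would span a
   disjoint edge; hence at least three parts are hit, once each. *)
Lemma outer_P3_hits a b c : outer_P3 a b c ->
  [/\ #|K| = 4, {in [:: a; b; c], forall v, #|hits v| = 1},
      {in [:: a; b; c] &, forall v w i, i \in hits v -> i \in hits w -> v = w} &
      {in [:: a; b; c], forall v i x, i \in hits v -> x \in part i -> adj v x}].
Proof.
move=> P3; have /and5P[/and3P[aO bO cO] ab bc nac ac] := P3.
pose U := hits a :|: hits b :|: hits c.
have UP v i : v \in [:: a; b; c] -> i \in hits v -> i \in U.
  by rewrite !(inE, in_setU) => /or3P[]/eqP-> ->; rewrite ?orbT.
have missed : #|K :\: U| <= 1.
  apply/card_le1_eqP => j i /setDP[jK jU] /setDP[iK iU]; apply/eqP/idPn => ij.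
  have [v vP /orP[vi|vj]] := outer_P3_touch P3 iK jK ij (part_refl iK) (part_refl jK).
    by case/negP: iU; apply: (UP v) => //; apply: mem_hits vi => //; apply: part_refl.
  by case/negP: jU; apply: (UP v) => //; apply: mem_hits vj => //; apply: part_refl.
have cardK := cardsID U K; have leU := subset_leq_card (subsetIr K U).
have /leP := card_hits aO; have /leP := card_hits bO; have /leP := card_hits cO.
move=> /leP hc /leP hb /leP ha.
(* Three sets of size at most 1 must cover all but one of at least 4 indices. Inclusion-exclusion in
   three groupings lets [lia] derive that they are disjoint singletons and [#|K| = 4]. *)
have UI1 := cardsUI (hits a :|: hits b) (hits c).
have UI2 := cardsUI (hits a) (hits b).
have UI3 := cardsUI (hits a :|: hits c) (hits b).
have UI4 := cardsUI (hits a) (hits c).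
have UI5 := cardsUI (hits b :|: hits c) (hits a).
have UI6 := cardsUI (hits b) (hits c).
have EU2 : hits a :|: hits c :|: hits b = U by rewrite /U setUAC.
have EU3 : hits b :|: hits c :|: hits a = U by rewrite /U setUC setUA.
rewrite -/U in UI1; rewrite EU2 in UI3; rewrite EU3 in UI5.
have [cK [h1 h2 h3] [d1 d2 d3]] : [/\ #|K| = 4,
    [/\ #|hits a| = 1, #|hits b| = 1 & #|hits c| = 1] &
    [/\ #|hits a :&: hits b| = 0, #|hits a :&: hits c| = 0
      & #|hits b :&: hits c| = 0]] by split; [lia|split; lia|split; lia].
have disj A B (i : G) : #|A :&: B| = 0 -> i \in A -> i \in B -> False.
  by move/cards0_eq/setP/(_ i); rewrite !inE => + iA iB; rewrite iA iB.
have uniq : {in [:: a; b; c] &,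
    forall v w i, i \in hits v -> i \in hits w -> v = w}.
  move=> v w; rewrite !inE => /or3P[]/eqP-> /or3P[]/eqP-> i iv iw //; exfalso;
  by [apply: disj d1 _ _; eassumption|apply: disj d2 _ _; eassumption|apply: disj d3 _ _; eassumption].
split=> // [v|v vP i x iv xi].
  by rewrite !inE => /or3P[]/eqP->.
(* The edge from [x] to the missed vertex [l] must be touched at [x], and only [v] hits the part of
   [x]. *)
have [l lKU] : exists l, l \in K :\: U by apply/set0Pn; rewrite -card_gt0; lia.
have /setDP[lK lU] := lKU.
have il : i != l by apply: contraNneq lU => <-; apply: UP iv.
have [w wP /orP[wx|wl]] := outer_P3_touch P3 (hitsK iv) lK il xi (part_refl lK).
  by rewrite (uniq v w vP wP i iv (mem_hits (hitsK iv) xi wx)).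
by case/negP: lU; apply: (UP w) => //; apply: mem_hits wl => //; apply: part_refl.
Qed.

Definition in_outer_P3 v := exists a b c, outer_P3 a b c /\ v \in [:: a; b; c].

(** Otherwise [w], [u], [y] would be an induced P3 with two vertices hitting the same part. *)
Lemma outer_twin i u w y :
  u \in outer -> w \in outer -> y \in outer -> i \in hits u -> i \in hits w ->
  adj u w -> y != w -> adj u y -> adj w y.
Proof.
move=> uO wO yO iu iw uw yw uy; apply/idPn => wy.
have P3 : outer_P3 w u y by rewrite /outer_P3 wO uO yO adj_sym uw uy wy eq_sym.
have [_ _ uniq _] := outer_P3_hits P3.
have := uniq u w _ _ i iu iw; rewrite !inE !eqxx !orbT => /(_ isT isT) E.
by rewrite E adj_irr in uw.
Qed.

Lemma in_outer_P3_outer v : in_outer_P3 v -> v \in outer.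
Proof.
case=> a [b [c [/and5P[/and3P[aO bO cO] _ _ _ _]]]].
by rewrite !(in_cons, in_nil) orbF => /or3P[]/eqP->.
Qed.

(** By the twin property [w] can replace [u] in the P3, which does not already contain [w] since its
    vertices hit distinct parts. *)
Lemma in_outer_P3_twin i u w :
  in_outer_P3 u -> w \in outer -> i \in hits u -> i \in hits w -> adj u w ->
  in_outer_P3 w.
Proof.
move=> uP wO iu iw uw; have uO := in_outer_P3_outer uP.
have wu : adj w u by rewrite adj_sym.
case: uP => a [b [c [P3 uabc]]]; have [_ _ uniq _] := outer_P3_hits P3.
have wabc : w \notin [:: a; b; c].
  by apply: contraTN uw => wabc; rewrite (uniq u w _ _ i) // adj_irr.
have /and5P[/and3P[aO bO cO] ab bc nac ac] := P3.
move: wabc; rewrite !inE !negb_or => /and3P[wa wb wc].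
have tw y : y \in outer -> y != u -> w != y -> adj w y = adj u y.
  move=> yO yu wy; apply/idP/idP; first exact: outer_twin iw iu wu yu.
  by apply: outer_twin iu iw uw _; rewrite 1?eq_sym.
have ba : b != a by rewrite eq_sym adj_neq.
have ca : c != a by rewrite eq_sym.
have [nab nbc] := (adj_neq ab, adj_neq bc).
have cb : c != b by rewrite eq_sym adj_neq.
move: uabc; rewrite !inE => /or3P[]/eqP E; rewrite {}E in tw.
- exists w, b, c; rewrite /outer_P3 wO bO cO bc !tw // ab nac wc.
  by rewrite !inE eqxx.
- exists a, w, c; rewrite /outer_P3 wO aO cO [adj a w]adj_sym !tw //.
  by rewrite [adj b a]adj_sym ab bc nac ac !inE eqxx orbT.
- exists a, b, w; rewrite /outer_P3 wO aO bO ab [adj b w]adj_sym [adj a w]adj_sym.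
  by rewrite !tw // ![adj c _]adj_sym bc nac eq_sym wa !inE eqxx !orbT.
Qed.

(** The neighborhood [N] is too large to be a clique, so [x] and all of [N] lie in induced P3's and
    each hits a part. Either some [z] in [N] shares the part of [x], or two members of [N] share a
    part. *)
Lemma exists_big_twin_class x :
  x \in outer -> #|K| <= #|outer :&: nbrs x| ->
  exists q q' i, [/\ in_outer_P3 q, q' \in outer, i \in hits q, i \in hits q'
                   & adj q q'].
Proof.
move=> xO; set N := _ :&: _ => leKN.
have NP z : z \in N -> z \in outer /\ adj x z by rewrite !inE => /andP[].
have [u [w [uN wN uw nuw]]] : exists u w, [/\ u \in N, w \in N, u != w & ~~ adj u w].
  have : ~~ clique N.
    apply/negP => clN; have xN : x \notin N by rewrite !inE adj_irr andbF.
    have [k kN] := maxclique_nonadj clN leKN xN.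
    by case: (NP k kN) => _ ->.
  rewrite negb_forall_in => /exists_inP[u uN].
  rewrite negb_forall_in => /exists_inP[w wN]; rewrite negb_imply => /andP[uw nuw].
  by exists u, w.
have NP3 z t : z \in N -> t \in N -> z != t -> ~~ adj z t -> outer_P3 z x t.
  move=> /NP[zO xz] /NP[tO xt] zt nzt.
  by rewrite /outer_P3 zO xO tO adj_sym xz xt nzt.
(* If [z] misses [u] or [w], the P3 passes through [x]; otherwise it is [u], [z], [w]. *)
have inP3 z : z \in N -> in_outer_P3 z.
  move=> zN; have [[[uO xu] [wO xw]] [zO xz]] := (NP u uN, NP w wN, NP z zN).
  have [->|zu] := eqVneq z u; first by exists u, x, w; rewrite NP3 // !inE eqxx.
  have [->|zw] := eqVneq z w; first by exists u, x, w; rewrite NP3 // !inE eqxx !orbT.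
  have [uz|nuz] := boolP (adj z u); last by exists z, x, u; rewrite NP3 // !inE eqxx.
  have [wz|nwz] := boolP (adj z w); last by exists z, x, w; rewrite NP3 // !inE eqxx.
  by exists u, z, w; rewrite /outer_P3 uO wO zO adj_sym uz wz nuw uw !inE eqxx orbT.
have hit z : in_outer_P3 z -> exists i, i \in hits z.
  case=> a [b [c [P3 zP]]]; have [_ /(_ z zP)/eqP/cards1P[i ->] _ _] := outer_P3_hits P3.
  by exists i; rewrite inE.
have P3x : in_outer_P3 x by exists u, x, w; rewrite NP3 // !inE eqxx orbT.
have [i ix] := hit x P3x.
have [/exists_inP[z zN iz]|none] := boolP [exists z in N, i \in hits z].
  by have [zO xz] := NP z zN; exists x, z, i.
pose g z := odflt z [pick j in hits z].
have gP z : z \in N -> g z \in hits z.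
  move=> zN; rewrite /g; case: pickP => //= none_z.
  by have [j] := hit z (inP3 z zN); rewrite none_z.
(* Pigeonhole: at least [#|K|] vertices of [N] hit only parts indexed by [K :\ i]. The two found are
   adjacent, since otherwise they would form with [x] a P3 hitting a part twice. *)
have /dinjectivePn[z zN [t /andP[/= tz tN] gzt]] : ~~ dinjectiveb g N.
  apply/negP => /dinjectiveP injg.
  have: g @: N \subset K :\ i.
    apply/subsetP => _ /imsetP[z zN ->]; rewrite !inE (hitsK (gP z zN)) andbT.
    apply: contraNneq none => gz; apply/exists_inP; exists z => //.
    by rewrite -gz gP.
  move/subset_leq_card; rewrite card_in_imset // leqNgt => /negP; apply.
  by rewrite (leq_trans _ leKN) // [ltnRHS](cardsD1 i K) (hitsK ix).
exists z, t, (g z); split; [exact: inP3|by case: (NP t tN)|exact: gP|by rewrite gzt gP|].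
apply/idPn => nzt; rewrite eq_sym in tz.
have [_ _ uniq _] := outer_P3_hits (NP3 z t zN tN tz nzt).
have := uniq z t _ _ (g z) (gP z zN); rewrite gzt gP // !inE !eqxx !orbT.
by move=> /(_ isT isT isT) E; rewrite E eqxx in tz.
Qed.


(** * Coloring the outer vertices and the whole graph *)

Definition palette : {set option G} := None |: Some @: K.

Definition allowed (y : G) := palette :\: Some @: hits y.

Lemma twin_class_list_coloring q q' i :
  in_outer_P3 q -> q' \in outer -> i \in hits q -> i \in hits q' -> adj q q' ->
  exists f, list_coloring allowed outer f.
Proof.
move=> qP3 q'O iq iq' qq'; have qO := in_outer_P3_outer qP3; have iK := hitsK iq.
have q'P3 := in_outer_P3_twin qP3 q'O iq iq' qq'.
have q'q : adj q' q by rewrite adj_sym.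
have [a [b [c [P3 _]]]] := qP3.
have /and5P[/and3P[aO bO cO] ab bc nac ac] := P3.
have [cardK _ uniqP3 _] := outer_P3_hits P3.
pose Q := [set y in outer | (i \in hits y) && ((y == q) || adj q y)].
pose N := [set y in outer | adj q y && (i \notin hits y)].
have indepN : {in N &, forall y z, ~~ adj y z}.
  move=> y z; rewrite [y \in _]inE [z \in _]inE.
  case/and3P=> yO qy iy /and3P[zO qz iz].
  apply/negP => yz.
  have iadj v : in_outer_P3 v -> i \in hits v -> adj i v.
    case=> a' [b' [c' [P3' vP]]] iv; rewrite adj_sym.
    by have [_ _ _ full] := outer_P3_hits P3'; apply: full (part_refl iK).
  have q'adj v : v \in outer -> adj q v -> i \notin hits v -> adj q' v.
    move=> vO qv iv; apply: (outer_twin qO q'O vO iq iq') => //.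
    by apply: contraNneq iv => ->.
  (* The K4 on [q], [q'], [y], [z] and the vertex [i], adjacent to [q] and [q'] because each is
     complete to its part. *)
  have : adj i y || adj i z.
    apply: (@HVN_free_adj G q q' y z i HVNfree) => //;
    by [apply: q'adj | apply: iadj | apply: outerNK].
  rewrite ![adj i _]adj_sym => /orP[yi|zi].
    by rewrite (mem_hits iK (part_refl iK) yi) in iy.
  by rewrite (mem_hits iK (part_refl iK) zi) in iz.
(* Such a [v] is [q] or, by the twin property, a neighbor of [q]; not being in [N], it hits part
   [i]. So no edge leaves [Q] within [outer :\: N]. *)
have closedQ u v : u \in Q -> v \in outer :\: N -> adj u v -> v \in Q.
  rewrite inE => /and3P[uO iu uq] /setDP[vO vN] uv.
  have [vq|vq] := eqVneq v q; first by rewrite vq inE qO iq eqxx.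
  have qv : adj q v.
    have [<-//|uq'] := eqVneq u q; rewrite (negbTE uq') /= in uq.
    by apply: (outer_twin uO qO vO iu iq) => //; rewrite adj_sym.
  by move: vN; rewrite [_ \in N]inE [_ \in Q]inE vO qv negbK orbT andbT.
have [||f [fL fadj]] := @P3_free_list_coloring _ _ q (fun y => K :\: hits y) (outer :\: N).
- move=> u v w uS vS wS uv vw uw; apply/idPn => nuw.
  have P3' : outer_P3 u v w.
    move: uS vS wS => /setDP[uO _] /setDP[vO _] /setDP[wO _].
    by rewrite /outer_P3 uO vO wO uv vw uw nuw.
  have [_ _ uniq _] := outer_P3_hits P3'.
  (* With [v], its neighbor [u] would lie in [Q] too, and both would hit part [i]. Hence the P3 has
     no edge to [Q], and [qq'] completes a forbidden P3 + P2. *)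
  have vQ : v \notin Q.
    apply/negP => vQ.
    have uQ : u \in Q by apply: (closedQ v); rewrite // adj_sym.
    have E : u = v.
      by apply: (uniq u v _ _ i); [rewrite mem_head | rewrite !inE eqxx orbT
        | move: uQ; rewrite inE => /and3P[] | move: vQ; rewrite inE => /and3P[]].
    by rewrite E adj_irr in uv.
  have QN y z : y \in Q -> z \in [:: u; v; w] -> ~~ adj y z.
    move=> yQ zuvw; apply/negP => yz.
    have zS : z \in outer :\: N by move: zuvw; rewrite !(in_cons, in_nil) orbF => /or3P[]/eqP->.
    have zQ := closedQ y z yQ zS yz.
    move: zuvw; rewrite !(in_cons, in_nil) orbF => /or3P[]/eqP E; rewrite E in zQ.
    - by rewrite (closedQ u v) in vQ.
    - by rewrite zQ in vQ.
    - by rewrite (closedQ w v) // adj_sym in vQ.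
  have qQ : q \in Q by rewrite inE qO iq eqxx.
  have q'Q : q' \in Q by rewrite inE q'O iq' qq' orbT.
  have := P3_cup_P2_free_adj P3P2free uv vw nuw uw qq'.
  by rewrite !(negbTE (QN _ _ _ _)) // !inE eqxx ?orbT.
- move=> D sDS clD; apply: (small_list_coloring q).
  + by move=> y yD; apply: card_hits; have /setDP[] := subsetP sDS y yD.
  + exact: maxK.
  move=> j jK jD; rewrite ltnNge; apply/negP => leKD.
  have DO y : y \in D -> y \in outer by move=> yD; have /setDP[] := subsetP sDS y yD.
  (* D would be isolated in [outer], and an edge of D disjoint from the P3. *)
  have isolD v d : v \in outer -> v \notin D -> d \in D -> ~~ adj v d.
    move=> vO vD dD; apply/negP => vd.
    have [d' d'D] := maxclique_nonadj clD leKD vD; apply/negP; rewrite negbK.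
    have [<-//|dd'] := eqVneq d d'; rewrite adj_sym.
    apply: (outer_twin (DO d dD) (DO d' d'D) vO (jD d dD) (jD d' d'D)).
    - exact: (cliqueP _ clD).
    - by apply: contraNneq vD => ->.
    - by rewrite adj_sym.
  (* Adjacent [u], [v] on the P3 hit distinct parts, so they are not both in [D]; one alone is
     excluded by [isolD]. *)
  have nD u v : u \in [:: a; b; c] -> v \in [:: a; b; c] -> u \in outer ->
      v \in outer -> adj u v -> u \notin D.
    move=> uP vP uO vO uv; apply/negP => uD.
    have [vD|vD] := boolP (v \in D).
      by rewrite (uniqP3 u v uP vP j (jD u uD) (jD v vD)) adj_irr in uv.
    by have := isolD v u vO vD uD; rewrite adj_sym uv.
  have aD : a \notin D by apply: (nD a b); rewrite // !inE eqxx ?orbT.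
  have bD : b \notin D by apply: (nD b c); rewrite // !inE eqxx ?orbT.
  have cD : c \notin D by apply: (nD c b); rewrite ?[adj c b]adj_sym // !inE eqxx ?orbT.
  have /card_gt1P[d [d' [dD d'D dd']]] : 1 < #|D| by rewrite (leq_trans _ leKD) ?cardK.
  have := P3_cup_P2_free_adj P3P2free ab bc nac ac (cliqueP _ clD d d' dD d'D dd').
  by rewrite ![adj d _]adj_sym ![adj d' _]adj_sym !(negbTE (isolD _ _ _ _ _)).
have SO y : y \in outer -> y \notin N -> y \in outer :\: N.
  by move=> yO yN; apply/setDP.
exists (fun y => if y \in N then None else Some (f y)); split=> [y yO|y z yO zO yz].
  rewrite in_setD in_setU1; case: ifP => yN.
    by rewrite eqxx andbT; apply/imsetP => -[].
  have := fL y (SO y yO (negbT yN)); rewrite in_setD.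
  by rewrite !(mem_imset _ _ Some_inj).
case: ifP => yN; case: ifP => zN //; first by have := indepN y z yN zN; rewrite yz.
by have := fadj y z (SO y yO (negbT yN)) (SO z zO (negbT zN)) yz.
Qed.

Lemma card_palette : #|palette| = #|K|.+1.
Proof.
rewrite cardsU1 card_imset; last exact: Some_inj.
by rewrite (_ : _ \notin _) //; apply/imsetP => -[].
Qed.

Lemma outer_list_coloring : exists f, list_coloring allowed outer f.
Proof.
have [/exists_inP[x xO degx]|none] :=
  boolP [exists x in outer, #|K| <= #|outer :&: nbrs x|].
  have [q [q' [i [? ? ? ? ?]]]] := exists_big_twin_class xO degx.
  exact: (@twin_class_list_coloring q q' i).
apply: (greedy_list_coloring None) => A sAO /set0Pn[x xA]; exists x => //.
have xO := subsetP sAO x xA.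
have degx : #|outer :&: nbrs x| < #|K|.
  by rewrite ltnNge; apply: contra none => degx; apply/exists_inP; exists x.
apply: leq_ltn_trans (subset_leq_card (setSI _ sAO)) _; apply: leq_trans degx _.
(* At most one of the [#|K|.+1] colors is forbidden, leaving [#|K|], more than the degree of [x]. *)
have le1 : #|palette :&: Some @: hits x| <= 1.
  rewrite (leq_trans (subset_leq_card (subsetIr _ _))) // card_imset ?card_hits //.
  exact: Some_inj.
have := cardsID (Some @: hits x) palette; rewrite card_palette => cardK.
by rewrite -ltnS -cardK -[#|allowed x|.+1]add1n leq_add2r.
Qed.

Lemma chromatic_number_maxclique : chromatic_number G <= #|K|.+1.
Proof.
have [f [fL fadj]] := outer_list_coloring.
pose col x := if [pick i in K | x \in part i] is Some i then Some i else f x.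
have colP x : (exists i, [/\ i \in K, x \in part i & col x = Some i])
              \/ (x \in outer /\ col x = f x).
  rewrite /col; case: pickP => [i /andP[iK xi]|none]; [left|right].
    by exists i.
  split=> //; rewrite inE; apply/forall_inP => i iK.
  by have := none i; rewrite /= iK => /negbT.
rewrite -card_palette; apply: (chromatic_number_le (f := col)) => [x|x y xy].
  have [[i [iK _ ->]]|[xO ->]] := colP x.
    by rewrite !inE imset_f.
  by have := fL x xO; rewrite inE => /andP[].
(* The list of [v] omits the colors of the parts that [v] hits. *)
have partouter u v i : i \in K -> u \in part i -> v \in outer -> adj v u -> f v != Some i.
  move=> iK ui vO vu; have := fL v vO; rewrite inE => /andP[+ _].
  by apply: contraNneq => ->; apply/imset_f/(mem_hits iK ui vu).
have [[i [iK xi ->]]|[xO ->]] := colP x; have [[j [jK yj ->]]|[yO ->]] := colP y.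
- apply: contraTneq xy => -[E]; rewrite E in xi; exact: (part_indep jK xi yj).
- by rewrite eq_sym; apply: (partouter x y); rewrite // adj_sym.
- exact: (partouter y x).
- exact: fadj.
Qed.

End MaximumClique.

Theorem theorem3p6 (G : sgraph) :
  induced_free P3_cup_P2 G ->
  induced_free HVN G ->
  4 <= clique_number G ->
  chromatic_number G <= clique_number G + 1.
Proof.
move=> P3P2free HVNfree; rewrite addn1.
have cl0 : clique (set0 : {set G}) by apply/cliqueP => x y; rewrite inE.
(* The maximum is attained by some clique because the empty set makes the index family nonempty. *)
have [|K clK cardK] := @eq_bigmax_cond _ (@clique G) (fun A => #|A|).
  by apply/card_gt0P; exists set0.
rewrite /clique_number cardK => K_ge4.
apply: chromatic_number_maxclique => // A clA.
by rewrite -cardK; apply: leq_bigmax_cond.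
Qed.
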